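(* Let $\mathbb{F}$ be a field of characteristic zero and let $(L,\varphi)$ be a finite-dimensional quadratic Lie algebra over $\mathbb{F}$ with no simple ideals. Let $R$ be the solvable radical of $L$, let $S$ be a Levi factor of $L$ (so $L=S\oplus R$), and let $R^\perp=\{x\in L:\varphi(x,R)=0\}$. Then $R^\perp\subseteq R$. Moreover, define $\hat{\varphi}(x+R^\perp,y+R^\perp)=\varphi(x,y)$ for $x,y\in R$, and define the Lie homomorphism $\Phi_S\colon S\to\operatorname{Der}_{\hat\varphi}(R/R^\perp)$ by $\Phi_S(x)(y+R^\perp)=[x,y]+R^\perp$. Then $L$ is isomorphic (as a Lie algebra) to the double extension $(R/R^\perp)_S=S\oplus R/R^\perp\oplus S^*$ of $(R/R^\perp,\hat\varphi)$ by $(S,\Phi_S)$, with bilinear form $\hat\varphi_S$. Furthermore, $L$ is isometrically isomorphic to $(R/R^\perp)_S$ when the latter is endowed with the bilinear form $\hat\varphi_S+\phi$, where $\phi$ is the symmetric bilinear form on $(R/R^\perp)_S$ with $\phi|_{S\times S}=\varphi|_{S\times S}$ and $\phi(u,v)=0$ whenever $u\in R/R^\perp\oplus S^*$ (and $v\in (R/R^\perp)_S$ arbitrary).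
   Context: A quadratic Lie algebra is a Lie algebra $L$ with a nondegenerate symmetric bilinear form $\varphi$ that is invariant: $\varphi([x,y],z)+\varphi(y,[x,z])=0$ for all $x,y,z$. For a quadratic Lie algebra $(V,\psi)$, $\operatorname{Der}_\psi(V)$ denotes the Lie algebra of derivations $d$ of $V$ that are skew-adjoint for $\psi$, i.e. $\psi(d(x),x')+\psi(x,d(x'))=0$. Double extension: given a quadratic Lie algebra $(V,\psi)$, a Lie algebra $B$ and a Lie homomorphism $\phi_0\colon B\to\operatorname{Der}_\psi(V)$, the double extension of $(V,\psi)$ by $(B,\phi_0)$ is the vector space $V_B=B\oplus V\oplus B^*$ with bracket $[b+x+\beta,\,b'+x'+\beta']=[b,b']+\phi_0(b)(x')-\phi_0(b')(x)+[x,x']+w(x,x')+\beta\circ\operatorname{ad}b'-\beta'\circ\operatorname{ad}b$, where $w(x,x')\in B^*$ is given by $w(x,x')(b)=\psi(\phi_0(b)(x),x')$, and with the symmetric bilinear form $\psi_B(b+x+\beta,\,b'+x'+\beta')=\beta(b')+\beta'(b)+\psi(x,x')$ (for $b,b'\in B$, $x,x'\in V$, $\beta,\beta'\in B^*$). In the theorem, $V=R/R^\perp$, $\psi=\hat\varphi$, $B=S$, $\phi_0=\Phi_S$, and $\hat\varphi_S$ denotes the resulting form $\psi_B$. All vector spaces are finite dimensional and the field has characteristic zero. *)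

(* Defs.v *)
From HB Require Import structures.
From mathcomp Require Import all_boot all_order all_algebra.
Set Implicit Arguments. Unset Strict Implicit. Unset Printing Implicit Defensive.
Import GRing.Theory.
Local Open Scope ring_scope.

Section LieDefs.
Variable F : fieldType.

Definition bilinear_map (U W : lmodType F) (X : lmodType F) (f : U -> W -> X) :=
  (forall a x y z, f (a *: x + y) z = a *: f x z + f y z) /\
  (forall a x y z, f z (a *: x + y) = a *: f z x + f z y).

Definition bilinear_form (U W : lmodType F) (f : U -> W -> F) :=
  (forall a x y z, f (a *: x + y) z = a * f x z + f y z) /\
  (forall a x y z, f z (a *: x + y) = a * f z x + f z y).

Variable V : vectType F.

Definition is_lie (br : V -> V -> V) :=
  [/\ bilinear_map br, (forall x, br x x = 0) &
      (forall x y z, br x (br y z) + br y (br z x) + br z (br x y) = 0)].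

Definition is_quadratic (br : V -> V -> V) (phi : V -> V -> F) :=
  [/\ is_lie br, bilinear_form phi, (forall x y, phi x y = phi y x),
      (forall x, (forall y, phi x y = 0) -> x = 0) &
      (forall x y z, phi (br x y) z + phi y (br x z) = 0)].

(* the subspace [U, W] spanned by brackets (by bilinearity, spanned by the
   brackets of basis vectors) *)
Definition brspan (br : V -> V -> V) (U W : {vspace V}) : {vspace V} :=
  (\sum_(u <- vbasis U) \sum_(w <- vbasis W) <[br u w]>)%VS.

Definition subalgebra (br : V -> V -> V) (A : {vspace V}) :=
  forall x y, x \in A -> y \in A -> br x y \in A.

Definition ideal_in (br : V -> V -> V) (A I : {vspace V}) :=
  (I <= A)%VS /\ forall x y, x \in A -> y \in I -> br x y \in I.

Definition ideal br I := ideal_in br fullv I.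

Fixpoint derived (br : V -> V -> V) (I : {vspace V}) (k : nat) : {vspace V} :=
  if k is k'.+1 then brspan br (derived br I k') (derived br I k') else I.

Definition solvable br I := exists k, derived br I k = 0%VS.

Definition solvable_radical br R :=
  [/\ ideal br R, solvable br R & forall I, ideal br I -> solvable br I -> (I <= R)%VS].

Definition simple_in br (A : {vspace V}) :=
  brspan br A A != 0%VS /\ forall I, ideal_in br A I -> I = 0%VS \/ I = A.

Definition no_simple_ideals br := forall I, ideal br I -> ~ simple_in br I.

Definition semisimple_in br (A : {vspace V}) :=
  forall I, ideal_in br A I -> solvable br I -> I = 0%VS.

Definition levi_factor br (R S : {vspace V}) :=
  [/\ subalgebra br S, semisimple_in br S, (S + R)%VS = fullv & (S :&: R)%VS = 0%VS].

End LieDefs.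

Definition subbr (F : fieldType) (V : vectType F) (br : V -> V -> V) (S : {vspace V})
  (u v : subvs_of S) : subvs_of S := vsproj S (br (vsval u) (vsval v)).

Definition skew_derivation (F : fieldType) (W : vectType F) (brW : W -> W -> W)
  (psi : W -> W -> F) (d : W -> W) :=
  [/\ (forall a x y, d (a *: x + y) = a *: d x + d y),
      (forall x y, d (brW x y) = brW (d x) y + brW x (d y)) &
      (forall x y, psi (d x) y + psi x (d y) = 0)].

Definition der_hom (F : fieldType) (B W : vectType F) (brB : B -> B -> B)
  (brW : W -> W -> W) (psi : W -> W -> F) (phi0 : B -> W -> W) :=
  [/\ (forall a b b' x, phi0 (a *: b + b') x = a *: phi0 b x + phi0 b' x),
      (forall b, skew_derivation brW psi (phi0 b)) &
      (forall b b' x, phi0 (brB b b') x = phi0 b (phi0 b' x) - phi0 b' (phi0 b x))].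

Section DoubleExt.
Variables (F : fieldType) (B W : vectType F).
Variables (brB : B -> B -> B) (brW : W -> W -> W) (psi : W -> W -> F)
          (phi0 : B -> W -> W).

Definition dext := (B * W * 'Hom(B, F^o))%type.

Definition dext_w (x x' : W) : 'Hom(B, F^o) := linfun (fun b => (psi (phi0 b x) x' : F^o)).

Definition dual_ad (beta : 'Hom(B, F^o)) (b : B) : 'Hom(B, F^o) :=
  linfun (fun b0 => beta (brB b b0)).

Definition dext_br (u v : dext) : dext :=
  let: (b, x, beta) := u in let: (b', x', beta') := v in
  (brB b b', phi0 b x' - phi0 b' x + brW x x',
   dext_w x x' + dual_ad beta b' - dual_ad beta' b).

Definition dext_form (u v : dext) : F :=
  let: (b, x, beta) := u in let: (b', x', beta') := v in
  beta b' + beta' b + psi x x'.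

End DoubleExt.

Definition lie_iso (F : fieldType) (V D : vectType F) (brV : V -> V -> V)
  (brD : D -> D -> D) (f : {linear V -> D}) :=
  bijective f /\ forall x y, f (brV x y) = brD (f x) (f y).

Arguments subbr {F V} br S u v.
Arguments dext_br {F B W} brB brW psi phi0 u v.
Arguments dext_form {F B W} psi u v.
Arguments der_hom {F B W} brB brW psi phi0.

(* Main.v *)
(* Since [Rp] commutes with [R], [S :&: Rp] is an ideal of the whole algebra
   without nonzero solvable ideals; if nonzero, it would contain a simple ideal.
   So it is zero. The derived series of [S :&: (Rp + R)] ends up in [S :&: Rp],
   so [S :&: (Rp + R)] is solvable, hence zero, that is [Rp <= R].
   The isometry sends [s + y], with [s] in [S] and [y] in [R], to
   [(s, pi y, phi y)]: since [phi] is nondegenerate and [Rp <= R], it is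
   bijective, and no complement of [Rp] in [R] has to be chosen. *)
Require Import Defs.
From HB Require Import structures.
From mathcomp Require Import all_boot all_order all_algebra.
Set Implicit Arguments. Unset Strict Implicit. Unset Printing Implicit Defensive.
Import GRing.Theory.
Local Open Scope ring_scope.

(** * Linear maps and bilinear forms on finite-dimensional spaces *)

Section LinearAlgebra.
Variable F : fieldType.

Lemma linear_bundle (U W : lmodType F) (f : U -> W) :
  (forall a x y, f (a *: x + y) = a *: f x + f y) ->
  exists g : {linear U -> W}, g =1 f.
Proof.
move=> lf.
by exists (HB.pack_for {linear U -> W} f (GRing.isLinear.Build F U W _ f lf)).
Qed.

(** [linfun] accepts any function, but computes it only when that function is linear. The duals in
    [dext_w] and [dual_ad] are built from bare functions, so each of their evaluations passes
    through this lemma. *)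
Lemma linfunK (U W : vectType F) (f : U -> W) :
  (forall a x y, f (a *: x + y) = a *: f x + f y) -> linfun f =1 f.
Proof.
by move=> lf x; exact: (lfunE (HB.pack_for {linear U -> W} f
  (GRing.isLinear.Build F U W _ f lf))).
Qed.

Variables (V : vectType F) (phi : V -> V -> F).
Hypothesis phi_bil : bilinear_form phi.

Lemma formDl x y z : phi (x + y) z = phi x z + phi y z.
Proof. by have := phi_bil.1 1 x y z; rewrite scale1r mul1r. Qed.

Lemma formDr x y z : phi z (x + y) = phi z x + phi z y.
Proof. by have := phi_bil.2 1 x y z; rewrite scale1r mul1r. Qed.

Lemma form0l z : phi 0 z = 0.
Proof. by apply: (addrI (phi 0 z)); rewrite -formDl !addr0. Qed.

Lemma form0r z : phi z 0 = 0.
Proof. by apply: (addrI (phi z 0)); rewrite -formDr !addr0. Qed.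

Lemma formZl a x z : phi (a *: x) z = a * phi x z.
Proof. by have := phi_bil.1 a x 0 z; rewrite form0l !addr0. Qed.

Lemma formZr a x z : phi z (a *: x) = a * phi z x.
Proof. by have := phi_bil.2 a x 0 z; rewrite form0r !addr0. Qed.

Lemma formBl x y z : phi (x - y) z = phi x z - phi y z.
Proof. by rewrite formDl -scaleN1r formZl mulN1r. Qed.

Lemma form_suml (I : finType) (f : I -> V) z :
  phi (\sum_i f i) z = \sum_i phi (f i) z.
Proof. by apply: (big_morph (phi^~ z)) => [x y|]; rewrite ?formDl ?form0l. Qed.

Lemma form_sumr (I : finType) (f : I -> V) z :
  phi z (\sum_i f i) = \sum_i phi z (f i).
Proof. by apply: (big_morph (phi z)) => [x y|]; rewrite ?formDr ?form0r. Qed.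

(** [U] is the kernel of the linear map sending [x] to the functional [phi x] precomposed with the
    projection onto [J], which sees only the values on [J]. *)
Lemma orthogonal_space (J : {vspace V}) :
  exists U : {vspace V}, forall x, x \in U <-> (forall y, y \in J -> phi x y = 0).
Proof.
have lf x : forall a y z,
    phi x (projv J (a *: y + z)) =
    a *: (phi x (projv J y) : F^o) + (phi x (projv J z) : F^o).
  by move=> a y z; rewrite linearP phi_bil.2.
have [g gE] : exists g : {linear V -> 'Hom(V, F^o)},
    g =1 (fun x => linfun (fun y => phi x (projv J y) : F^o)).
  apply: linear_bundle => a x y; apply/lfunP => z.
  by rewrite add_lfunE scale_lfunE !linfunK // phi_bil.1.
exists (lker (linfun g)) => x; rewrite memv_ker lfunE gE; split=> [/eqP g0 y yJ | h].
  by move/lfunP: g0 => /(_ y); rewrite linfunK // projv_id // lfunE.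
by apply/eqP/lfunP => y; rewrite linfunK // lfunE /= h ?memv_proj.
Qed.

(* The Gram matrix of a basis is invertible. *)
Lemma riesz_representation (J : {vspace V}) (g : V -> F) :
    (forall x, x \in J -> (forall y, y \in J -> phi x y = 0) -> x = 0) ->
    (forall a x y, g (a *: x + y) = a * g x + g y) ->
  exists2 j, j \in J & forall y, y \in J -> phi j y = g y.
Proof.
move=> ndJ lg; pose e := vbasis J; pose n : nat := \dim J.
have eJ (i : 'I_n) : e`_i \in J.
  by apply/vbasis_mem/mem_nth; rewrite size_tuple.
pose comb (v : 'rV[F]_n) := \sum_i v 0 i *: e`_i.
have combJ v : comb v \in J by apply: memv_suml => i _; apply: memvZ.
pose G := \matrix_(i < n, j < n) phi e`_i e`_j.
have combG v (j : 'I_n) : phi (comb v) e`_j = (v *m G) 0 j.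
  by rewrite form_suml mxE; apply: eq_bigr => i _; rewrite formZl mxE.
(* If [v *m G = 0], then [comb v] is orthogonal to every basis vector, hence to [J], hence zero by
   [ndJ]; freeness of the basis gives [v = 0]. *)
have Gfree : row_free G.
  apply: inj_row_free => v vG0.
  have c0 : comb v = 0.
    apply: ndJ => // y /coord_vbasis ->; rewrite form_sumr big1 // => i _.
    by rewrite formZr combG vG0 mxE mulr0.
  have /freeP fr : free e by apply: basis_free (vbasisP J).
  by apply/rowP => i; rewrite (fr (v 0) c0) mxE.
rewrite row_free_unit in Gfree.
pose v := (\row_j g e`_j) *m invmx G.
have [g' g'E] : exists g' : {linear V -> F^o}, g' =1 g by apply: linear_bundle.
exists (comb v) => // y /coord_vbasis ->.
rewrite form_sumr -g'E linear_sum; apply: eq_bigr => i _.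
by rewrite formZr linearZ /= g'E combG mulmxKV // mxE.
Qed.

End LinearAlgebra.

(** * Bracket calculus, spans of brackets and derived series *)

Section LieSubspaces.
Variables (F : fieldType) (V : vectType F) (br : V -> V -> V).
Hypothesis br_lie : is_lie br.
Implicit Types (U W X A I : {vspace V}).

Lemma brDl x y z : br (x + y) z = br x z + br y z.
Proof. by have [[bl _] _ _] := br_lie; have := bl 1 x y z; rewrite !scale1r. Qed.

Lemma brDr x y z : br z (x + y) = br z x + br z y.
Proof. by have [[_ bl] _ _] := br_lie; have := bl 1 x y z; rewrite !scale1r. Qed.

Lemma br0l z : br 0 z = 0.
Proof. by apply: (addrI (br 0 z)); rewrite -brDl !addr0. Qed.

Lemma br0r z : br z 0 = 0.
Proof. by apply: (addrI (br z 0)); rewrite -brDr !addr0. Qed.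

Lemma brZl a x z : br (a *: x) z = a *: br x z.
Proof. by have [[bl _] _ _] := br_lie; have := bl a x 0 z; rewrite br0l !addr0. Qed.

Lemma brZr a x z : br z (a *: x) = a *: br z x.
Proof. by have [[_ bl] _ _] := br_lie; have := bl a x 0 z; rewrite br0r !addr0. Qed.

Lemma brC x y : br x y = - br y x.
Proof.
have [_ alt _] := br_lie; apply/eqP; rewrite -addr_eq0.
by have := alt (x + y); rewrite brDl !brDr !alt add0r addr0 => ->.
Qed.

Lemma jacobi_der x y z : br x (br y z) = br (br x y) z + br y (br x z).
Proof.
have [_ _ jac] := br_lie; apply/eqP; rewrite -subr_eq0 opprD.
have := jac x y z; rewrite (brC z (br x y)) (brC z x) -scaleN1r brZr scaleN1r.
by rewrite addrAC addrA => ->.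
Qed.

Lemma mem_brspan U W u w : u \in U -> w \in W -> br u w \in brspan br U W.
Proof.
move=> /coord_vbasis -> /coord_vbasis ->.
rewrite (big_morph (br^~ _) (fun x y => brDl x y _) (br0l _)).
apply: memv_suml => i _; rewrite brZl (big_morph (br _) (fun x y => brDr x y _) (br0r _)).
apply: memvZ; apply: memv_suml => j _; rewrite brZr; apply: memvZ.
have iU : (vbasis U)`_i \in vbasis U by apply: mem_nth; rewrite size_tuple.
have jW : (vbasis W)`_j \in vbasis W by apply: mem_nth; rewrite size_tuple.
rewrite /brspan (big_rem _ iU) (big_rem _ jW) /= memvE -addvA.
exact: addvSl.
Qed.

Lemma brspan_sub U W X :
  (forall u w, u \in U -> w \in W -> br u w \in X) -> (brspan br U W <= X)%VS.
Proof.
move=> h; rewrite /brspan big_seq; apply: (big_ind (fun A => A <= X)%VS) => [|A B|u uU].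
- exact: sub0v.
- by rewrite subv_add => ->.
rewrite big_seq; apply: (big_ind (fun A => A <= X)%VS) => [|A B|w wW]; first exact: sub0v.
  by rewrite subv_add => ->.
by rewrite -memvE h // vbasis_mem.
Qed.

Lemma derived_sub A m : subalgebra br A -> (derived br A m <= A)%VS.
Proof.
move=> sA; elim: m => //= m IH.
by apply: brspan_sub => u w uD wD; apply: sA; apply: (subvP IH).
Qed.

Lemma abelian_solvable A : (forall x y, x \in A -> y \in A -> br x y = 0) -> solvable br A.
Proof.
move=> ab; exists 1%N; apply/eqP; rewrite -subv0 /=.
by apply: brspan_sub => u w uA wA; rewrite ab ?mem0v.
Qed.

Lemma ideal_subalgebra I : ideal br I -> subalgebra br I.
Proof. by move=> [_ iI] x y _ yI; apply: iI; rewrite ?memvf. Qed.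

End LieSubspaces.

(** * Ideals and orthogonals in a quadratic Lie algebra *)

Section Quadratic.
Variables (F : fieldType) (V : vectType F) (br : V -> V -> V) (phi : V -> V -> F).
Hypothesis quad : is_quadratic br phi.
Implicit Types (A I J : {vspace V}).

Let br_lie : is_lie br. Proof. by case: quad. Qed.
Let phi_bil : bilinear_form phi. Proof. by case: quad. Qed.
Let phiC x y : phi x y = phi y x. Proof. by case: quad. Qed.

Lemma form_nondegenerate x : (forall y, phi x y = 0) -> x = 0.
Proof. by case: quad => _ _ _ nd _; apply: nd. Qed.

Lemma form_invariant x y z : phi (br x y) z = - phi y (br x z).
Proof. by case: quad => _ _ _ _ inv; apply/eqP; rewrite -addr_eq0 inv. Qed.

Lemma form_assoc x y z : phi (br x y) z = phi x (br y z).
Proof. by rewrite (brC br_lie) -scaleN1r formZl // form_invariant mulN1r opprK. Qed.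

Lemma orthogonal_ideal I (U : {vspace V}) : ideal br I ->
  (forall x, x \in U <-> (forall y, y \in I -> phi x y = 0)) -> ideal br U.
Proof.
move=> [_ iI] UE; split=> [|x y _ /UE yU]; first exact: subvf.
by apply/UE => z zI; rewrite form_invariant yU ?oppr0 // iI ?memvf.
Qed.

(** For every [z], the value [phi (br x y) z = phi x (br y z)] vanishes because [br y z] lies in
    [I]; nondegeneracy concludes. *)
Lemma br_orthogonal_ideal I x y : ideal br I ->
  (forall z, z \in I -> phi x z = 0) -> y \in I -> br x y = 0.
Proof.
move=> [_ iI] xI yI; apply: form_nondegenerate => z.
by rewrite form_assoc xI // (brC br_lie) memvN iI ?memvf.
Qed.

(* The form is nondegenerate on such an ideal, so the algebra is the sum of the
   ideal and its orthogonal, which commute. Hence the ideals of a minimal one are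
   ideals of the whole algebra, and it is simple. *)
Lemma ideal_eq0 J : no_simple_ideals br -> ideal br J ->
  (forall I, ideal br I -> (I <= J)%VS -> solvable br I -> I = 0%VS) -> J = 0%VS.
Proof.
move=> nosimple; have [n] := ubnP (\dim J); elim: n J => // n IHn J ltJn iJ semiJ.
have [U UE] := orthogonal_space phi_bil J.
have iU := orthogonal_ideal iJ UE.
(* [U] commutes with [J], so the intersection is an abelian ideal and [semiJ] applies. *)
have JU0 : (J :&: U = 0)%VS.
  apply: semiJ; last 1 first.
  - apply: abelian_solvable => x y; rewrite !memv_cap => /andP[_ /UE xU] /andP[yJ _].
    exact: (br_orthogonal_ideal iJ).
  - split=> [|x y _]; first exact: subvf.
    by rewrite !memv_cap => /andP[yJ yU]; rewrite iJ.2 ?iU.2 ?memvf.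
  - exact: capvSl.
have ndJ x : x \in J -> (forall y, y \in J -> phi x y = 0) -> x = 0.
  by move=> xJ xU; apply/eqP; rewrite -memv0 -JU0 memv_cap xJ; apply/UE.
have [//|Jn0] := eqVneq J 0%VS.
(* A nonzero [J] is shown to be simple. It is not abelian, since otherwise [semiJ] would apply to
   [J] itself. A proper ideal of [J] is an ideal of the whole algebra of smaller dimension, hence
   zero by induction. *)
case: (nosimple J iJ); split.
  by apply: contraNneq Jn0 => brJ0; rewrite [J]semiJ //; exists 1%N.
move=> I [IJ iI].
have [->|neqIJ] := eqVneq I J; [by right|left].
have ideal_I : ideal br I.
  split=> [|x y _ yI]; first exact: subvf.
  (* [j] represents [phi x] on [J], so [x - j] is orthogonal to [J] and commutes with it: on [J],
     [x] acts as the element [j] of [J]. *)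
  have [j jJ jE] :=
    riesz_representation (g := phi x) phi_bil ndJ (fun a y z => phi_bil.2 a y z x).
  have yJ := subvP IJ _ yI.
  have -> : br x y = br j y; last exact: iI.
  rewrite -[x in LHS](subrK j) brDl // (br_orthogonal_ideal iJ) ?add0r // => z zJ.
  by rewrite formBl // jE ?subrr.
apply: IHn ideal_I _ => [|I' iI' I'I].
  rewrite ltnS in ltJn; apply: leq_trans ltJn.
  by rewrite (ltn_leqif (dimv_leqif_eq IJ)).
exact/semiJ/(subv_trans I'I).
Qed.

Lemma radical_orthogonal_sub (R S Rp : {vspace V}) :
  no_simple_ideals br -> solvable_radical br R -> levi_factor br R S ->
  (forall x, x \in Rp <-> (forall y, y \in R -> phi x y = 0)) -> (Rp <= R)%VS.
Proof.
move=> nosimple [iR [m Rm0] maxR] [algS semiS SR SR0] RpE.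
have iRp := orthogonal_ideal iR RpE.
have RpR x y : x \in Rp -> y \in R -> br x y = 0.
  by move=> /RpE xR; apply: br_orthogonal_ideal iR xR.
(* A solvable ideal inside the intersection lies in both [R] and [S], hence is zero. To see that the
   intersection is an ideal, write [x = s + r]: the part [r] acts by zero on [Rp], and [s] preserves
   [S]. *)
have SRp0 : (S :&: Rp = 0)%VS.
  apply: ideal_eq0 nosimple _ _ => [|I iI ISRp solI]; last first.
    apply/eqP; rewrite -subv0 -SR0 subv_cap maxR // andbT.
    exact/(subv_trans ISRp)/capvSl.
  split=> [|x y _]; first exact: subvf.
  rewrite !memv_cap => /andP[yS yRp]; rewrite (iRp.2 x) ?memvf // andbT.
  have /memv_addP[s sS [r rR ->]] : x \in (S + R)%VS by rewrite SR memvf.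
  by rewrite brDl // (brC br_lie r y) (RpR y r) // oppr0 addr0 algS.
(* The mixed brackets vanish, so [br (i + r) (i' + r')] is [br i i' + br r r'], and only the second
   term has to descend the derived series. *)
have derK k : (derived br (S :&: (Rp + R)) k <= S :&: (Rp + derived br R k))%VS.
  elim: k => //= k IHk; apply: brspan_sub => u w /(subvP IHk) + /(subvP IHk).
  rewrite !memv_cap => /andP[uS /memv_addP[i iRp1 [r rR uE]]].
  move=> /andP[wS /memv_addP[i' iRp2 [r' rR' wE]]].
  have subR := subvP (derived_sub k (ideal_subalgebra iR)).
  apply/andP; split; first exact: algS.
  have ir' : br i r' = 0 := RpR _ _ iRp1 (subR _ rR').
  have ri' : br r i' = 0 by rewrite (brC br_lie) RpR ?oppr0 ?subR.
  rewrite uE wE (brDl br_lie) !(brDr br_lie) ir' ri' addr0 add0r.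
  exact: memv_add (iRp.2 _ _ (memvf _) iRp2) (mem_brspan br_lie rR rR').
have K0 : (S :&: (Rp + R) = 0)%VS.
  apply: semiS; last first.
    by exists m; apply/eqP; move: (derK m); rewrite Rm0 addv0 SRp0 subv0.
  split=> [|x y xS]; first exact: capvSl.
  rewrite !memv_cap => /andP[yS yRpR]; apply/andP; split; first exact: algS.
  case/memv_addP: yRpR => i iRp1 [r rR ->].
  rewrite (brDr br_lie).
  exact: memv_add (iRp.2 _ _ (memvf _) iRp1) (iR.2 _ _ (memvf _) rR).
apply/subvP => x xRp.
have /memv_addP[s sS [r rR xE]] : x \in (S + R)%VS by rewrite SR memvf.
suff -> : x = r by [].
have : s \in (S :&: (Rp + R))%VS.
  by rewrite memv_cap sS -[s](addrK r) -xE memv_add ?memvN.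
by rewrite K0 memv0 => /eqP s0; rewrite xE s0 add0r.
Qed.

End Quadratic.

(** * The quotient of the radical and its double extension *)

Section QuotientDoubleExtension.
Variables (F : fieldType) (V W : vectType F) (br : V -> V -> V) (phi : V -> V -> F).
Variables (R S Rp : {vspace V}) (pi : {linear V -> W}) (brW : W -> W -> W).
Variables (psi : W -> W -> F) (PhiS : subvs_of S -> W -> W).
Hypothesis quad : is_quadratic br phi.
Hypothesis iR : ideal br R.
Hypothesis algS : subalgebra br S.
Hypothesis SR : (S + R)%VS = fullv.
Hypothesis SR0 : (S :&: R)%VS = 0%VS.
Hypothesis RpE : forall x, x \in Rp <-> (forall y, y \in R -> phi x y = 0).
Hypothesis RpR : (Rp <= R)%VS.
Hypothesis pi_onto : forall w : W, exists2 x, x \in R & pi x = w.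
Hypothesis pi_eq0 : forall x, x \in R -> (pi x = 0 <-> x \in Rp).
Hypothesis brWE : forall x y, x \in R -> y \in R -> brW (pi x) (pi y) = pi (br x y).
Hypothesis psiE : forall x y, x \in R -> y \in R -> psi (pi x) (pi y) = phi x y.
Hypothesis PhiE : forall s y, y \in R -> PhiS s (pi y) = pi (br (vsval s) y).

Let br_lie : is_lie br. Proof. by case: quad. Qed.
Let phi_bil : bilinear_form phi. Proof. by case: quad. Qed.
Let phiC x y : phi x y = phi y x. Proof. by case: quad. Qed.
Let brR x y : y \in R -> br x y \in R. Proof. by apply: iR.2; rewrite memvf. Qed.
Let linR a x y : x \in R -> y \in R -> a *: x + y \in R.
Proof. by move=> xR yR; rewrite memvD ?memvZ. Qed.

(** All identities descend from lifts in [R]. Nondegeneracy holds because an element of [R]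
    orthogonal to [R] lies in [Rp], which [pi] kills. *)
Lemma quotient_is_quadratic : is_quadratic brW psi.
Proof.
split=> [||x y|x x0|x y z].
- split.
  + split=> a x y z; have [x' xR <-] := pi_onto x; have [y' yR <-] := pi_onto y;
      have [z' zR <-] := pi_onto z; have lR := linR a xR yR; rewrite -linearP !brWE //.
      by rewrite (brDl br_lie) (brZl br_lie) linearP.
    by rewrite (brDr br_lie) (brZr br_lie) linearP.
  + move=> x; have [x' xR <-] := pi_onto x; rewrite brWE //.
    by have [_ -> _] := br_lie; rewrite linear0.
  + move=> x y z; have [x' xR <-] := pi_onto x; have [y' yR <-] := pi_onto y.
    have [z' zR <-] := pi_onto z; rewrite !brWE ?brR // -!linearD.
    by have [_ _ ->] := br_lie; rewrite linear0.
- split=> a x y z; have [x' xR <-] := pi_onto x; have [y' yR <-] := pi_onto y;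
    have [z' zR <-] := pi_onto z; have lR := linR a xR yR; rewrite -linearP !psiE //.
    by rewrite phi_bil.1.
  by rewrite phi_bil.2.
- by have [x' xR <-] := pi_onto x; have [y' yR <-] := pi_onto y; rewrite !psiE.
- have [x' xR xE] := pi_onto x; rewrite -xE; apply/(pi_eq0 xR)/RpE => y yR.
  by rewrite -psiE // xE.
have [x' xR <-] := pi_onto x; have [y' yR <-] := pi_onto y.
have [z' zR <-] := pi_onto z; rewrite !brWE // !psiE ?brR //.
by rewrite (form_invariant quad) addNr.
Qed.

Lemma vsval_subbr s t : vsval (subbr br S s t) = br (vsval s) (vsval t).
Proof. by rewrite vsprojK // algS // subvsP. Qed.

(** The Jacobi identity gives both the derivation rule and the compatibility with brackets in [S];
    invariance of [phi] gives skew-adjointness. *)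
Lemma quotient_der_hom : der_hom (subbr br S) brW psi PhiS.
Proof.
split=> [a b c x|b|b c x].
- have [x' xR <-] := pi_onto x; rewrite !PhiE // linearP.
  by rewrite (brDl br_lie) (brZl br_lie) linearP.
- split=> [a x y|x y|x y]; have [x' xR <-] := pi_onto x; have [y' yR <-] := pi_onto y.
  + have lR := linR a xR yR; rewrite -linearP !PhiE //.
    by rewrite (brDr br_lie) (brZr br_lie) linearP.
  + rewrite brWE // !PhiE ?brR // !brWE ?brR // -linearD.
    by rewrite (jacobi_der br_lie).
  by rewrite !PhiE // !psiE ?brR // (form_invariant quad) addNr.
have [x' xR <-] := pi_onto x; rewrite !PhiE ?brR // -linearB vsval_subbr.
by rewrite [br (vsval b) (br _ _)](jacobi_der br_lie) addrK.
Qed.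

Let D := dext (subvs_of S) W.
(** [sp] and [rp] are the components along the direct sum of [S] and [R]. *)
Let sp (x : V) : subvs_of S := vsproj S (daddv_pi S R x).
Let rp (x : V) : V := x - vsval (sp x).

Let sp_add (s : subvs_of S) y : y \in R -> sp (vsval s + y) = s.
Proof.
move=> yR; rewrite /sp linearD /= daddv_pi_id ?subvsP //.
have -> : daddv_pi S R y = 0; last by rewrite addr0 vsvalK.
have := daddv_pi_add SR0 (w := y); rewrite SR memvf => /(_ isT).
rewrite [daddv_pi R S y]daddv_pi_id 1?capvC //.
by move/(canRL (addrK y)); rewrite subrr.
Qed.

Let rp_add (s : subvs_of S) y : y \in R -> rp (vsval s + y) = y.
Proof. by move=> yR; rewrite /rp sp_add // addrAC subrr add0r. Qed.

Let decomp x : exists s : subvs_of S, exists2 y, y \in R & x = vsval s + y.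
Proof.
have /memv_addP[s sS [y yR ->]] : x \in (S + R)%VS by rewrite SR memvf.
by exists (vsproj S s), y; rewrite ?vsprojK.
Qed.

(** This supplies the dual component of the isometry. Restricted to [Rp], it is an isomorphism onto
    the dual of [S]. *)
Let res (y : V) : 'Hom(subvs_of S, F^o) := linfun (fun s => phi y (vsval s) : F^o).

Let resE y s : res y s = phi y (vsval s).
Proof. by rewrite linfunK // => a t u; rewrite linearP phi_bil.2. Qed.

Let dual_adE (beta : 'Hom(subvs_of S, F^o)) s t :
  dual_ad (subbr br S) beta s t = beta (subbr br S s t).
Proof.
rewrite linfunK // => a u v; rewrite -linearP; congr (beta _).
by rewrite /subbr [vsval (a *: u + v)]linearP (brDr br_lie) (brZr br_lie) linearP.
Qed.

Let dext_wE y y' t : y \in R -> y' \in R ->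
  dext_w psi PhiS (pi y) (pi y') t = phi (br (vsval t) y) y'.
Proof.
move=> yR yR'; have [lin _ _] := quotient_der_hom.
have [_ [psil _] _ _ _] := quotient_is_quadratic.
by rewrite linfunK ?PhiE ?psiE ?brR // => a u v; rewrite lin psil.
Qed.

(** One map serves for both isomorphism claims. [dext_form] vanishes on the copy of [S], while [phi]
    may not; the added term restores [phi] there. *)
Lemma quotient_double_extension :
  exists f : {linear V -> D},
    lie_iso br (dext_br (subbr br S) brW psi PhiS) f /\
    forall x y,
      dext_form psi (f x) (f y) + phi (vsval (f x).1.1) (vsval (f y).1.1) = phi x y.
Proof.
have sp_lin a x y : sp (a *: x + y) = a *: sp x + sp y by rewrite /sp !linearP.
have rp_lin a x y : rp (a *: x + y) = a *: rp x + rp y.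
  by rewrite /rp sp_lin [vsval _]linearP scalerBr opprD addrACA.
have [f fE0] : exists f : {linear V -> D},
    f =1 (fun x => (sp x, pi (rp x), res (rp x)) : D).
  apply: linear_bundle => a x y; congr (_, _, _).
  - exact: sp_lin.
  - by rewrite rp_lin linearP.
  apply/lfunP => s; rewrite add_lfunE scale_lfunE !resE rp_lin.
  by rewrite phi_bil.1.
have fE (s : subvs_of S) y : y \in R -> f (vsval s + y) = (s, pi y, res y).
  by move=> yR; rewrite fE0 sp_add // rp_add.
exists f; split; last first.
  move=> x x'; have [s [y yR ->]] := decomp x; have [s' [y' yR' ->]] := decomp x'.
  rewrite !fE //= !resE psiE //.
  rewrite !(formDl phi_bil) !(formDr phi_bil) (phiC (vsval s) y').
  by rewrite [LHS](ACl (4*2*(1*3)))%AC.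
split.
  (* In the kernel [s = 0]; then [pi y = 0] makes [y] orthogonal to [R] and [res y = 0] makes it
     orthogonal to [S], hence to everything. *)
  have fx0 x : f x = 0 -> x = 0.
    have [s [y yR ->]] := decomp x.
    rewrite fE // => -[-> /(pi_eq0 yR)/RpE yRp /lfunP res0].
    rewrite linear0 add0r; apply: (form_nondegenerate quad) => z.
    have [t [z' zR ->]] := decomp z.
    by rewrite (formDr phi_bil) (yRp z') // addr0 -resE res0 lfunE.
  have inj : injective f := raddf_inj fx0.
  have surj d : exists x, f x == d.
    case: d => [[s w] beta]; have [y yR <-] := pi_onto w.
    (* A lift [y] of [w] has the wrong dual component. The correction [r] represents the defect
       [beta - res y], extended by zero on [R]; so [r] lies in [Rp], and adding it leaves [pi y]
       unchanged. *)
    have [r _ rE] : exists2 r, r \in fullv &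
        forall z, z \in fullv -> phi r z = beta (sp z) - phi y (vsval (sp z)).
      apply: (riesz_representation (g := fun z => beta (sp z) - phi y (vsval (sp z))) phi_bil).
        by move=> x _ x0; apply: (form_nondegenerate quad) => z; apply: x0; rewrite memvf.
      by move=> a u v; rewrite sp_lin !linearP /= phi_bil.2 mulrBr opprD addrACA.
    have rRp : r \in Rp.
      apply/RpE => z zR; rewrite rE ?memvf //.
      have -> : sp z = 0 by have := sp_add 0 zR; rewrite linear0 add0r.
      by rewrite !linear0 (form0r phi_bil) subrr.
    have rR := subvP RpR _ rRp.
    exists (vsval s + (y + r)); rewrite fE ?memvD //; apply/eqP; congr (_, _, _).
      by rewrite linearD /= (iffRL (pi_eq0 rR)) ?addr0.
    apply/lfunP => t; rewrite resE (formDl phi_bil) rE ?memvf //.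
    by rewrite -[vsval t]addr0 sp_add ?mem0v // addr0 addrC subrK.
  (* [bijective] asks for an explicit inverse; [surj] uses the boolean equality so that [xchoose]
     can pick a preimage. *)
  exists (fun d => xchoose (surj d)) => [x|d]; last exact/eqP/(xchooseP (surj d)).
  by apply: inj; apply/eqP/(xchooseP (surj (f x))).
move=> x x'; have [s [y yR ->]] := decomp x; have [s' [y' yR' ->]] := decomp x'.
rewrite !fE //=.
(* The bracket is sorted into its component in [S] and its component in the ideal [R], so that [fE]
   applies. *)
have -> : br (vsval s + y) (vsval s' + y') =
    vsval (subbr br S s s') + (br (vsval s) y' - br (vsval s') y + br y y').
  rewrite vsval_subbr !(brDl br_lie) !(brDr br_lie) (brC br_lie y (vsval s')).
  by rewrite !addrA.
rewrite fE ?memvD ?memvN ?brR //; congr (_, _, _).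
  by rewrite linearD linearB /= !PhiE // brWE.
(* At [t], invariance turns the brackets of [s] with [y'] and of [s'] with [y] into the two
   [dual_ad] terms, and [phi (br y y') t] into [phi (br t y) y'], the [dext_w] term. *)
apply/lfunP => t; rewrite !add_lfunE opp_lfunE !dual_adE !resE dext_wE // !vsval_subbr.
rewrite (formDl phi_bil) (formBl phi_bil) (form_invariant quad (vsval s)).
rewrite (form_invariant quad (vsval s')) opprK (form_assoc quad (vsval t)).
by rewrite (phiC (vsval t)) [LHS](ACl (3*2*1))%AC.
Qed.

End QuotientDoubleExtension.

(** [W] with [pi] ranges over all models of the quotient of [R] by [Rp]. As [pi] maps [R] onto [W],
    the hypotheses determine [brW], [psi] and [PhiS]. *)
Theorem theorem3p2 (F : fieldType) (V : vectType F)
    (br : V -> V -> V) (phi : V -> V -> F) (R S Rp : {vspace V}) :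
  [pchar F] =i pred0 ->
  is_quadratic br phi ->
  no_simple_ideals br ->
  solvable_radical br R ->
  levi_factor br R S ->
  (forall x, x \in Rp <-> (forall y, y \in R -> phi x y = 0)) ->
  (Rp <= R)%VS /\
  (forall (W : vectType F) (pi : {linear V -> W}) (brW : W -> W -> W)
          (psi : W -> W -> F) (PhiS : subvs_of S -> W -> W),
     (forall w : W, exists2 x, x \in R & pi x = w) ->
     (forall x, x \in R -> (pi x = 0 <-> x \in Rp)) ->
     (forall x y, x \in R -> y \in R -> brW (pi x) (pi y) = pi (br x y)) ->
     (forall x y, x \in R -> y \in R -> psi (pi x) (pi y) = phi x y) ->
     (forall s y, y \in R -> PhiS s (pi y) = pi (br (vsval s) y)) ->
     [/\ is_quadratic brW psi,
         der_hom (subbr br S) brW psi PhiS,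
         (exists f : {linear V -> dext (subvs_of S) W},
            lie_iso br (dext_br (subbr br S) brW psi PhiS) f) &
         (exists f : {linear V -> dext (subvs_of S) W},
            lie_iso br (dext_br (subbr br S) brW psi PhiS) f /\
            forall x y,
              dext_form psi (f x) (f y) + phi (vsval (f x).1.1) (vsval (f y).1.1)
              = phi x y)]).
Proof.
move=> _ quad nosimple radR leviS RpE.
have RpR := radical_orthogonal_sub quad nosimple radR leviS RpE.
split=> // W pi brW psi PhiS pi_onto pi_eq0 brWE psiE PhiE.
have [iR _ _] := radR; have [algS _ SR SR0] := leviS.
have [f [f_iso f_isom]] := quotient_double_extension quad iR algS SR SR0 RpE RpR
  pi_onto pi_eq0 brWE psiE PhiE.
split; [| |by exists f|by exists f].
- exact: quotient_is_quadratic quad iR RpE pi_onto pi_eq0 brWE psiE.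
- exact: quotient_der_hom quad iR algS pi_onto brWE psiE PhiE.
Qed.
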